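(* For each integer $e \geq 3$ there is a graph $G \in \mathcal{W}_3$ on exactly $2^{4e-1} + 2^{2e} + 1$ vertices. That is, there exists a graph $G$ with $2^{4e-1} + 2^{2e} + 1$ vertices which has diameter $2$, contains no triangle and no (not necessarily induced) subgraph isomorphic to $K_{2,3}$, and is not a star.
   Context: All graphs are finite and simple. For an integer $t \ge 1$, $\mathcal{W}_t$ denotes the class of graphs other than stars (graphs $K_{1,m}$) that have diameter $2$ and contain neither a triangle $C_3$ nor a $K_{2,t}$ as a subgraph. The diameter of a graph is the maximum distance between two of its vertices. *)

(* Defs.v *)
From mathcomp Require Import all_boot.

Set Implicit Arguments.
Unset Strict Implicit.
Unset Printing Implicit Defensive.

Record sgraph := SGraph {
  vertex :> finType;
  adj : rel vertex;
  adj_sym : symmetric adj;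
  adj_irrefl : irreflexive adj
}.

Arguments adj {s} x y.

(* Not necessarily induced: the embedding need not reflect adjacency. *)
Definition contains_subgraph (H G : sgraph) : Prop :=
  exists f : H -> G, injective f /\ (forall x y : H, adj x y -> adj (f x) (f y)).

Definition isomorphic (H G : sgraph) : Prop :=
  exists f : H -> G, bijective f /\ (forall x y : H, adj (f x) (f y) = adj x y).

Definition is_walk (G : sgraph) (x y : G) (p : seq G) : Prop :=
  path adj x p /\ last x p = y.

(* A functional relation: no [d] satisfies it when [x] and [y] lie in different
   components, so such pairs are at infinite distance. *)
Definition is_distance (G : sgraph) (x y : G) (d : nat) : Prop :=
  (exists p : seq G, is_walk x y p /\ size p = d) /\
  (forall p : seq G, is_walk x y p -> d <= size p).

(* The maximum of all distances exists and equals [d]; in particular [G] is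
   nonempty and connected. *)
Definition has_diameter (G : sgraph) (d : nat) : Prop :=
  (forall x y : G, exists k : nat, is_distance x y k /\ k <= d) /\
  (exists x y : G, is_distance x y d).

Section Cycle.
Variable n : nat.

Definition cycle_adj : rel 'I_n :=
  fun i j => (i != j) && ((j == ordS i) || (i == ordS j)).

Lemma cycle_adj_sym : symmetric cycle_adj.
Proof. by move=> i j; rewrite /cycle_adj eq_sym orbC. Qed.

Lemma cycle_adj_irrefl : irreflexive cycle_adj.
Proof. by move=> i; rewrite /cycle_adj eqxx. Qed.

(* The cycle C_n for n >= 3. *)
Definition cycle_graph : sgraph := SGraph cycle_adj_sym cycle_adj_irrefl.
End Cycle.

Section CompleteBipartite.
Variables m n : nat.

Definition bipartite_adj : rel ('I_m + 'I_n)%type :=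
  fun u v => match u, v with
             | inl _, inr _ | inr _, inl _ => true
             | _, _ => false
             end.

Lemma bipartite_adj_sym : symmetric bipartite_adj.
Proof. by move=> [i|i] [j|j]. Qed.

Lemma bipartite_adj_irrefl : irreflexive bipartite_adj.
Proof. by case. Qed.

Definition complete_bipartite : sgraph :=
  SGraph bipartite_adj_sym bipartite_adj_irrefl.
End CompleteBipartite.

Definition is_star (G : sgraph) : Prop :=
  exists m : nat, isomorphic (complete_bipartite 1 m) G.

Definition class_W (t : nat) (G : sgraph) : Prop :=
  [/\ ~ is_star G,
      has_diameter G 2,
      ~ contains_subgraph (cycle_graph 3) G
    & ~ contains_subgraph (complete_bipartite 2 t) G].

(* Main.v *)
(** Let K be the field with 2^(2e-1) elements and I = K x {0,1}.  The function f
of de Caen, Mathon and Moorhouse, f((x,i),(y,j)) = x^2 y + x y^2 if i = j and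
(x + y)^3 otherwise, is symmetric, vanishes on the diagonal, and for X <> Y the
map Z |-> f(X,Z) - f(Y,Z) is exactly 2-to-1 onto K.  Joining (X,a) to (Y,b) when
X <> Y and b - a = f(X,Y) therefore gives an antipodal 2^(2e-1)-fold cover of the
complete graph on I in which adjacent vertices have no common neighbour, and
non-adjacent vertices of distinct fibres have exactly two.  Vertices of one fibre
have none, which is repaired by adding a new vertex for each fibre, joined to the
whole fibre, and one last vertex joined to all the new ones. *)

Require Import Defs.
From mathcomp Require Import all_boot.
From mathcomp Require Import ssralg finalg finfield ring zify.

Set Implicit Arguments.
Unset Strict Implicit.
Unset Printing Implicit Defensive.

Import GRing.Theory.

(** * Membership in the class through numbers of common neighbours *)

Definition neighbours (G : sgraph) (u : G) : {set G} := [set w | adj u w].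

Lemma has_diameter2 (G : sgraph) :
  (forall u v : G, u != v -> ~~ adj u v ->
     exists w, adj u w && adj w v) ->
  (exists u v : G, (u != v) && ~~ adj u v) ->
  has_diameter G 2.
Proof.
move=> h2 [x0 [y0 /andP[nxy0 nadj0]]].
have dist2 (x y : G) : x != y -> ~~ adj x y -> is_distance x y 2.
  move=> nxy nadj; have [w /andP[xw wy]] := h2 _ _ nxy nadj; split.
    by exists [:: w; y]; rewrite /is_walk /= xw wy.
  move=> [|z [|z' p]] // [] /=; first by move=> _ exy; rewrite exy eqxx in nxy.
  by rewrite andbT => xz ezy; rewrite -ezy xz in nadj.
split; last by exists x0, y0; exact: dist2.
move=> x y; case: (eqVneq x y) => [<-|nxy].
  by exists 0; do 2!split => //; exists [::].
case: (boolP (adj x y)) => [axy|nadj]; last by exists 2; split => //; exact: dist2.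
exists 1; do 2!split => //; first by exists [:: y]; rewrite /is_walk /= axy.
by move=> [|z p] // [_ /= exy]; rewrite exy eqxx in nxy.
Qed.

(** Every edge of a star contains its centre, so two disjoint edges certify that a graph is not a
    star. *)
Lemma star_edges_meet (G : sgraph) (a b c d : G) :
  is_star G -> adj a b -> adj c d -> ~~ uniq [:: a; b; c; d].
Proof.
move=> [m [f [[g fK gK] fadj]]].
rewrite -[a]gK -[b]gK -[c]gK -[d]gK !fadj.
rewrite -[[:: _; _; _; _]]/(map f [:: g a; g b; g c; g d]).
rewrite (map_inj_uniq (can_inj fK)).
case: (g a) (g b) (g c) (g d) => [i|i] [j|j] // [k|k] [l|l] // _ _;
  rewrite ?(ord1 i) ?(ord1 j) ?(ord1 k) ?(ord1 l) //=; rewrite ?inE;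
  by rewrite ?eqxx ?orbT ?andbF.
Qed.

Lemma class_W_common_neighbours (t : nat) (G : sgraph) :
  0 < t ->
  (forall u v : G, adj u v -> [disjoint neighbours u & neighbours v]) ->
  (forall u v : G, u != v -> ~~ adj u v ->
     0 < #|neighbours u :&: neighbours v| < t) ->
  (exists a b c d : G, [&& adj a b, adj c d & uniq [:: a; b; c; d]]) ->
  class_W t G.
Proof.
move=> t_gt0 htri hcom [a [b [c [d /and3P[ab cd uabcd]]]]].
split.
- by move=> st; have := star_edges_meet st ab cd; rewrite uabcd.
- apply: has_diameter2 => [u v nuv nadj|].
    have /andP[/card_gt0P[w] + _] := hcom _ _ nuv nadj.
    by rewrite !inE => /andP[uw vw]; exists w; rewrite uw adj_sym vw.
  (* If [a] and [c] are adjacent, then [b] and [c] are not: [a], [b], [c] would form a triangle. *)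
  case: (boolP (adj a c)) => ac; last first.
    by exists a, c; rewrite ac andbT; move: uabcd => /=; rewrite !inE !negb_or;
       case/and4P=> /and3P[].
  exists b, c; move: uabcd; rewrite /= !inE !negb_or => /and4P[_ /andP[-> _] _ _].
  apply/negP => bc; have /pred0P/(_ c) := htri _ _ ab.
  by rewrite /= !inE ac bc.
- move=> [f [finj fadj]].
  pose i (k : nat) : 'I_3 := inord k.
  have fa (j k : nat) : j < 3 -> k < 3 -> j != k -> adj (f (i j)) (f (i k)).
    move=> j3 k3 njk; apply: fadj; rewrite /= /cycle_adj -!val_eqE /=.
    by rewrite /i !inordK //; case: j k j3 k3 njk => [|[|[|]]] [|[|[|]]].
  have /pred0P/(_ (f (i 2))) := htri _ _ (fa 0 1 isT isT isT).
  by rewrite /= !inE !fa.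
- move=> [f [finj fadj]].
  pose u := f (inl ord0); pose v := f (inl ord_max).
  have nuv : u != v by apply/eqP => /finj [].
  pose S := [set f (inr k) | k in [set: 'I_t]].
  have sS : S \subset neighbours u :&: neighbours v.
    by apply/subsetP => _ /imsetP[k _ ->]; rewrite !inE !fadj.
  have cS : #|S| = t.
    by rewrite card_imset ?cardsT ?card_ord // => k l /finj [].
  case: (boolP (adj u v)) => [auv|nadj].
    have := htri _ _ auv; rewrite -setI_eq0 => /eqP e0.
    rewrite e0 subset0 in sS; move: (cS); rewrite (eqP sS) cards0 => t0.
    by rewrite -t0 in t_gt0.
  have /andP[_] := hcom _ _ nuv nadj.
  by rewrite ltnNge -{1}cS (subset_leq_card sS).
Qed.

(** * The completed cover of a skew function with two-point difference fibres *)

Section CompletedCover.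

Variables (I : finType) (V : finZmodType) (f : I -> I -> V).
Local Open Scope ring_scope.

Hypothesis f_skew : forall x y, f y x = - f x y.
Hypothesis f_diag : forall x, f x x = 0.

(* [None] is the last vertex, [inl x] the new vertex of the fibre over [x], and
   [inr (x, a)] a vertex of the cover. *)
Definition cover_vertex : finType := option (I + I * V)%type.

Definition cover_adj : rel cover_vertex := fun u v =>
  match u, v with
  | None, Some (inl _) | Some (inl _), None => true
  | Some (inl x), Some (inr (y, _)) | Some (inr (y, _)), Some (inl x) => x == y
  | Some (inr (x, a)), Some (inr (y, b)) => (x != y) && (b - a == f x y)
  | _, _ => false
  end.

Lemma cover_adj_sym : symmetric cover_adj.
Proof.
move=> [[x|[x a]]|] [[y|[y b]]|] //=.
by rewrite eq_sym f_skew -eqr_oppLR opprB.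
Qed.

Lemma cover_adj_irrefl : irreflexive cover_adj.
Proof. by case=> [[x|[x a]]|] //=; rewrite eqxx. Qed.

Definition cover_graph : sgraph := SGraph cover_adj_sym cover_adj_irrefl.

Lemma card_cover_graph : #|cover_graph| = (#|I| * #|V| + #|I| + 1)%N.
Proof. by rewrite /= card_option card_sum card_prod addn1 addnC. Qed.

Hypothesis f_diff : forall x y (v : V), x != y ->
  #|[set z | f x z - f y z == v]| = 2%N.

(** Both [x] and [y] are solutions, and [f_diff] leaves room for only two. A common neighbour of
    adjacent cover vertices would yield a third. *)
Lemma diff_solutions_edge x y : x != y ->
  [set z | f x z - f y z == f x y] = [set x; y].
Proof.
move=> nxy; apply/esym/eqP; rewrite eqEcard f_diff // cards2 nxy andbT.
apply/subsetP => z; rewrite !inE => /orP[] /eqP->; rewrite f_diag.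
  by rewrite sub0r f_skew opprK.
by rewrite subr0.
Qed.

Lemma cover_triangle_free (u v : cover_graph) : adj u v ->
  [disjoint neighbours u & neighbours v].
Proof.
move=> uv; rewrite -setI_eq0; apply/eqP/setP => w; rewrite !inE.
move: u v w uv => [[x|[x a]]|] [[y|[y b]]|] [[z|[z c]]|] //=;
  rewrite ?andbF ?andbT //.
- by move=> /eqP<-; case: (eqVneq x z) => [<-|] //=; rewrite eqxx.
- by move=> /eqP<-; case: (eqVneq y z) => [<-|] //=; rewrite ?andbF.
- by move=> /andP[nxy _]; apply/negP => /andP[/eqP-> /eqP exy]; rewrite exy eqxx in nxy.
- move=> /andP[nxy /eqP ab].
  apply/negP => /andP[/andP[nxz /eqP ac] /andP[nyz /eqP bc]].
  have : z \in [set z | f x z - f y z == f x y].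
    by rewrite inE -ac -bc -ab opprB addrC addrA subrK.
  by rewrite diff_solutions_edge // !inE ![z == _]eq_sym (negPf nxz) (negPf nyz).
Qed.

Lemma cover_common_neighbours (u v : cover_graph) : u != v -> ~~ adj u v ->
  (0 < #|neighbours u :&: neighbours v| < 3)%N.
Proof.
move: u v.
have one (u v w : cover_graph) : neighbours u :&: neighbours v = [set w] ->
    (0 < #|neighbours u :&: neighbours v| < 3)%N by move=> ->; rewrite cards1.
have infty_affine x a :
  neighbours (None : cover_graph) :&: neighbours (Some (inr (x, a)) : cover_graph)
    = [set Some (inl x)].
  by apply/setP => -[[z|[z c]]|] //; rewrite !inE.
(* The witness is the only cover vertex over [x] adjacent to [(y, b)]. *)
have ideal_affine x y b : x != y ->
  neighbours (Some (inl x) : cover_graph) :&: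
  neighbours (Some (inr (y, b)) : cover_graph) = [set Some (inr (x, b + f y x))].
  move=> nxy; apply/setP => -[[z|[z c]]|]; rewrite !inE //=.
  rewrite (inj_eq Some_inj) (inj_eq inr_inj) xpair_eqE.
  case: (eqVneq x z) => [<-|] //=.
  by rewrite [y == x]eq_sym nxy /= subr_eq addrC.
move=> [[x|[x a]]|] [[y|[y b]]|] //=.
- move=> nuv _; apply: (one _ _ None); apply/setP => -[[z|[z c]]|]; rewrite !inE //=.
  by apply/negP => /andP[/eqP exz /eqP eyz]; rewrite exz eyz eqxx in nuv.
- by move=> _ nxy; apply: one; exact: ideal_affine.
- by move=> _ nxy; rewrite setIC; apply: one; apply: ideal_affine.
- move=> nuv nadj; case: (eqVneq x y) nuv nadj => [<-|nxy] nuv /= nadj.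
    apply: (one _ _ (Some (inl x))); apply/setP => -[[z|[z c]]|]; rewrite !inE //=.
      by rewrite andbb.
    apply/negP => /andP[/andP[_ /eqP ac] /andP[_ /eqP bc]].
    by move: nuv; rewrite -(subKr c a) ac -bc subKr eqxx.
  (* A common neighbour [(z, c)] has [c - a = f x z] and [c - b = f y z]; subtracting puts [z] in
     [S], and [z] determines [c]. *)
  pose S := [set z | f x z - f y z == b - a].
  suff -> : neighbours (Some (inr (x, a)) : cover_graph) :&:
      neighbours (Some (inr (y, b)) : cover_graph) =
      [set Some (inr (z, a + f x z)) | z in S].
    by rewrite card_imset ?f_diff // => z z' [].
  have key z c : ((c - a == f x z) && (c - b == f y z)) =
      ((c == a + f x z) && (z \in S)).
    rewrite subr_eq addrC; case: eqVneq => [->|] //=.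
    rewrite inE subr_eq [RHS]subr_eq -[RHS](inj_eq (addrI a)); congr (_ == _).
    by rewrite addrA (addrC a) subrK addrC.
  apply/setP => w; apply/idP/imsetP => [|[z zS ->]].
    case: w => [[z|[z c]]|]; rewrite !inE //=.
      by case/andP=> /eqP exz /eqP eyz; rewrite -exz -eyz eqxx in nxy.
    case/andP=> /andP[_ e1] /andP[_ e2].
    by have := key z c; rewrite e1 e2 => /esym/andP[/eqP-> zS]; exists z.
  rewrite !inE /=; have := key z (a + f x z); rewrite eqxx zS => /andP[-> ->].
  (* With [z = x] or [z = y], membership in [S] would read [b - a = f x y], making the two vertices
     adjacent. *)
  rewrite !andbT; apply/andP; split; apply: contraNneq nadj => ez;
    move: zS; rewrite inE -ez f_diag.
    by rewrite sub0r f_skew opprK eq_sym.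
  by rewrite subr0 eq_sym.
- by move=> _ _; rewrite setIC; apply: one; apply: infty_affine.
- by move=> _ _; apply: one; apply: infty_affine.
Qed.

Lemma class_W_cover_graph : (1 < #|I|)%N -> class_W 3 cover_graph.
Proof.
move=> /card_gt1P[x [y [_ _ nxy]]].
apply: class_W_common_neighbours => //.
- exact: cover_triangle_free.
- exact: cover_common_neighbours.
- exists None, (Some (inl x)), (Some (inl y)), (Some (inr (y, 0))).
  by rewrite /= eqxx !inE !(inj_eq Some_inj) (inj_eq inl_inj) (negPf nxy).
Qed.

End CompletedCover.

(** * Fibre sizes from an upper bound *)

Lemma card_fibers_eq (I V : finType) (g : I -> V) (k : nat) :
  (forall v, #|[set z | g z == v]| <= k) -> #|I| = k * #|V| ->
  forall v, #|[set z | g z == v]| = k.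
Proof.
move=> le cI v.
(* Fibre sizes and bounds both sum to [#|I|], so equality holds in every term. *)
have := leqif_sum (fun v (_ : true) => leqif_eq (le v)).
rewrite sum_nat_const => -[_].
have -> : \sum_v #|[set z | g z == v]| = #|I|.
  rewrite -sum1_card (partition_big g predT) //=.
  by apply: eq_bigr => w _; rewrite -sum1_card; apply: eq_bigl => z; rewrite inE.
by rewrite cI mulnC eqxx => /esym/forall_inP/(_ v isT)/eqP.
Qed.

(** * The function of de Caen, Mathon and Moorhouse in characteristic 2 *)

Section Gold.

Variable K : finFieldType.
Local Open Scope ring_scope.
Hypothesis K2 : 2%N \in [pchar K].
Hypothesis K_no_omega : forall s : K, s ^+ 2 + s + 1 != 0.

Definition gold_cocycle (X Y : K * bool) : K :=
  if X.2 == Y.2 then X.1 * Y.1 * (X.1 + Y.1) else (X.1 + Y.1) ^+ 3.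

Let two0 : 1 + 1 = 0 :> K. Proof. by rewrite -mulr2n -(pcharf0 K2). Qed.

(* [ring] does not use the characteristic: [c] is the explicit multiple of 2 by
   which the two sides differ as integer polynomials. *)
Let mod2 (c a b : K) : a = b + (1 + 1) * c -> a = b.
Proof. by rewrite two0 mul0r addr0. Qed.

Let oppK (x : K) : - x = x. Proof. by rewrite (oppr_pchar2 K2). Qed.

(** For [y != 0], the cofactor of [x - y] in [x ^+ 3 - y ^+ 3] is [y ^+ 2] times a value of
    [s ^+ 2 + s + 1], hence nonzero. *)
Lemma cube_inj : injective (fun x : K => x ^+ 3).
Proof.
move=> x y /= exy; case: (eqVneq y 0) exy => [->|y0 exy].
  by rewrite expr0n mulr0n => /eqP; rewrite expf_eq0 => /eqP.
have : (x - y) * (y ^+ 2 * ((x / y) ^+ 2 + x / y + 1)) = 0.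
  by transitivity (x ^+ 3 - y ^+ 3); [field | rewrite exy subrr].
move=> /eqP; rewrite !mulf_eq0 (negPf (K_no_omega _)) (negPf y0) !orbF.
by rewrite subr_eq0 => /eqP.
Qed.

Lemma gold_cocycle_skew X Y : gold_cocycle Y X = - gold_cocycle X Y.
Proof.
rewrite oppK /gold_cocycle eq_sym; case: ifP => _; last by rewrite addrC.
by rewrite [Y.1 * _]mulrC [Y.1 + _]addrC.
Qed.

Lemma gold_cocycle_diag X : gold_cocycle X X = 0.
Proof. by rewrite /gold_cocycle eqxx addrr_pchar2 // mulr0. Qed.

(** In characteristic 2 the two sides differ by [d ^+ 3 * (s ^+ 2 + s + 1)] with
    [s = (w + w') / d]. *)
Lemma quadratic_shift_neq (d w w' : K) : d != 0 ->
  d * w * (w + d) != d * w' * (w' + d) + d ^+ 3.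
Proof.
move=> d0; apply/negP => /eqP e.
have : d ^+ 3 * (((w + w') / d) ^+ 2 + (w + w') / d + 1) = 0.
  transitivity (d * w' * (w' + d) + d ^+ 3 - d * w * (w + d)); last by rewrite e subrr.
  by apply: (mod2 (c := d * w * w' + d * w ^+ 2 + d ^+ 2 * w)); field.
by move=> /eqP; rewrite mulf_eq0 expf_eq0 (negPf d0) (negPf (K_no_omega _)).
Qed.

(** If [i != j], the difference is a translated cube plus a constant on each copy of [K], so each
    copy holds at most one solution. If [i = j], it is quadratic on each copy and the two copies
    share no value, so all solutions are roots of one quadratic. *)
Lemma gold_cocycle_fiber_le X Y v : X != Y ->
  (#|[set Z | (gold_cocycle X Z - gold_cocycle Y Z)%R == v]| <= 2)%N.
Proof.
case: X Y => [x i] [y j] nXY.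
case: (eqVneq i j) nXY => [<-|nij] nXY; set S := [set Z | _]; last first.
  have cub (z : K) k : gold_cocycle (x, i) (z, k) - gold_cocycle (y, j) (z, k) =
      (z + (x + y)) ^+ 3 + x * y * (x + y) + if i == k then x ^+ 3 else y ^+ 3.
    rewrite oppK /gold_cocycle /=; case: (eqVneq i k) nij => [<-|nik] nij.
      rewrite eq_sym (negPf nij).
      apply: (mod2 (c := - (x ^+ 2 * z + x * z ^+ 2 + 2%:R * x ^+ 2 * y
        + 2%:R * x * y ^+ 2 + 3%:R * x * y * z + x ^+ 3))); ring.
    have -> : j == k by case: i j k nij nik {S nXY} => [] [] [].
    apply: (mod2 (c := - (y ^+ 2 * z + y * z ^+ 2 + 2%:R * x ^+ 2 * y
        + 2%:R * x * y ^+ 2 + 3%:R * x * y * z + y ^+ 3))); ring.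
  rewrite -card_bool; apply: (leq_card_in snd).
  move=> [z k] [z' k'] zS z'S /= ekk.
  move: zS z'S; rewrite -ekk !inE !cub => /eqP<- /eqP/addIr/addIr/cube_inj/addIr.
  by move=> ->.
have d0 : x - y != 0 by rewrite subr_eq0; apply: contraNneq nXY => ->.
set d := x - y in d0.
(* The shift by [x] gives both copies the same quadratic in [w], up to the constant [d ^+ 3]. *)
pose w k z := if i == k then z else z + x.
have quad (z : K) k : gold_cocycle (x, i) (z, k) - gold_cocycle (y, i) (z, k) =
   d * w k z * (w k z + d) + if i == k then 0 else d ^+ 3.
  rewrite oppK /gold_cocycle /w /d /=; case: ifP => _.
    by apply: (mod2 (c := y * z ^+ 2 + x * y * z)); ring.
  apply: (mod2 (c := (z + x) ^+ 3 - 2%:R * (z + x) ^+ 2 * (x - y)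
    + (z + x) * (x - y) ^+ 2 - (x - y) ^+ 3)); ring.
have [->|[[z k] zS]] := set_0Vmem S; first by rewrite cards0.
suff sub : S \subset [set (z, k); (z + d, k)].
  by apply: leq_trans (subset_leq_card sub) _; rewrite cards2; case: (_ != _).
apply/subsetP => -[z' k'] z'S; move: zS z'S; rewrite !inE !quad => /eqP<- /eqP.
case: (eqVneq k' k) => [->|nkk]; last first.
  case: (eqVneq i k) nkk => [<-|nik] nkk; rewrite ?addr0.
    by rewrite eq_sym (negPf nkk) => /esym/eqP; rewrite (negPf (quadratic_shift_neq _ _ _)).
  have -> : i == k' by case: i k k' nik nkk {S w quad nXY} => [] [] [].
  by rewrite addr0 => /eqP; rewrite (negPf (quadratic_shift_neq _ _ _)).
move=> /addIr e; rewrite !xpair_eqE eqxx !andbT.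
(* Within one copy, equal values force [w k z'] to be [w k z] or [w k z + d]. *)
have : d * ((w k z' - w k z) * (w k z' + (w k z + d))) = 0.
  by transitivity (d * w k z' * (w k z' + d) - d * w k z * (w k z + d));
    [ring | rewrite e subrr].
move=> /eqP; rewrite !mulf_eq0 (negPf d0) /= subr_eq0 addr_eq0 oppK /w.
by case: ifP => _ //; rewrite addrAC !(inj_eq (addIr _)).
Qed.

Lemma gold_cocycle_fiber X Y v : X != Y ->
  #|[set Z | gold_cocycle X Z - gold_cocycle Y Z == v]| = 2%N.
Proof.
(* The [2 * #|K|] points [Z] are spread over [#|K|] values, at most two on each. *)
move=> nXY; apply: (card_fibers_eq (g := fun Z => gold_cocycle X Z - gold_cocycle Y Z)).
  by move=> {}v; apply: gold_cocycle_fiber_le.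
by rewrite card_prod card_bool mulnC.
Qed.

End Gold.

(** * Choice of the field and the vertex count *)

Lemma no_primitive_cube_root (K : finFieldType) :
  2 \in [pchar K]%R -> #|K| = 2 %[mod 3] ->
  forall s : K, (s ^+ 2 + s + 1)%R != 0%R.
Proof.
move=> K2 cK s; apply/negP => /eqP e.
have s3 : (s ^+ 3 = 1)%R.
  apply/eqP; rewrite -subr_eq0; apply/eqP.
  transitivity ((s - 1) * (s ^+ 2 + s + 1))%R; first by ring.
  by rewrite e mulr0.
(* Since [s ^+ 3 = 1] and [#|K|] is 2 mod 3, the identity [s ^+ #|K| = s] becomes this one. *)
have ss : (s ^+ 2 = s)%R.
  by rewrite -[RHS]expf_card (divn_eq #|K| 3) cK exprD mulnC exprM s3 expr1n mul1r.
by move: e; rewrite ss addrr_pchar2 // add0r => /eqP; rewrite oner_eq0.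
Qed.

Theorem theorem1p2 (e : nat) (he : 3 <= e) :
  exists G : sgraph, class_W 3 G /\ #|G| = 2 ^ (4 * e - 1) + 2 ^ (2 * e) + 1.
Proof.
have e_gt0 : 0 < 2 * e - 1 by lia.
have [K K2 cK] := pPrimePowerField (isT : prime 2) e_gt0.
have K3 : forall s : K, (s ^+ 2 + s + 1)%R != 0%R.
  (* [#|K|] is [4 ^ (e - 1) * 2], and 4 is 1 mod 3. *)
  apply: no_primitive_cube_root => //; rewrite cK (_ : 2 * e - 1 = 2 * (e - 1) + 1); last by lia.
  by rewrite expnD expnM -modnMml -modnXm exp1n.
exists (cover_graph (gold_cocycle_skew K2)); split.
  apply: class_W_cover_graph => [x|x y v nxy|]; first exact: gold_cocycle_diag.
    exact: gold_cocycle_fiber.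
  by rewrite card_prod card_bool cK muln2 -addnn; lia.
(* There are [2 ^ (2 * e)] fibres, each with [2 ^ (2 * e - 1)] cover vertices. *)
rewrite card_cover_graph card_prod card_bool cK.
by rewrite -expnSr -expnD; congr (2 ^ _ + 2 ^ _ + 1); lia.
Qed.
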